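(* Let $\tilde{\mathcal E}\subset(\overline{\mathcal E},\subseteq)$ be chain compatible. Then, for all $k\in\mathbb Z$, $$H^{\tilde{\mathcal E}}_k:=\bigl(\{H_k(D)\mid D\in\tilde{\mathcal E}\},\{H_k(\mathcal I^{DE})\mid D,E\in\tilde{\mathcal E},\ D\subseteq E\}\bigr),$$ $$H^{\tilde{\mathcal E}}:=\bigl(\{H(D)\mid D\in\tilde{\mathcal E}\},\{H(\mathcal I^{DE})\mid D,E\in\tilde{\mathcal E},\ D\subseteq E\}\bigr)$$ with (partially ordered) index set $\tilde{\mathcal E}$ are direct systems of graded $\mathbb Z$-modules in the category of $\mathbb Z$-modules. In particular, both are direct systems of abelian groups and therefore admit direct limits. If the chain compatible set $\tilde{\mathcal E}\subset(\overline{\mathcal E},\subseteq)$ is not only partially ordered but in fact directed, then both direct systems allow passing to the direct limit of short exact sequences (that is, for short exact sequences of direct systems of $\mathbb Z$-modules over $\tilde{\mathcal E}$ in which they occur, the induced sequence of direct limits is again short exact), and one can assign to $\tilde{\mathcal E}$ a well-defined homology via direct limit: $$H_k(\tilde{\mathcal E}):=\varinjlim H^{\tilde{\mathcal E}}_k\quad\forall\,k\in\mathbb Z\qquad\text{and}\qquad H(\tilde{\mathcal E}):=\bigoplus_{k\in\mathbb Z}H_k(\tilde{\mathcal E}).$$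
   Context: Setting. $M$ is $\mathbb R^2$ or a closed surface of genus $g\ge 1$, $\omega$ is a symplectic (= area) form on $M$, $\varphi:M\to M$ is a symplectomorphism with hyperbolic fixed point $x$ (no eigenvalue of $D\varphi(x)$ has absolute value 1), with stable and unstable manifolds $W^s=\{p:\lim_{n\to\infty}\varphi^n(p)=x\}$ and $W^u=\{p:\lim_{n\to-\infty}\varphi^n(p)=x\}$ (injectively immersed curves). Assume $W^s$ and $W^u$ intersect transversely and are strongly intersecting (each of the two connected components of $W^u\setminus\{x\}$ intersects each of the two connected components of $W^s\setminus\{x\}$), and that $\varphi$ is $W$-orientation preserving (it preserves the orientations of $W^s$ and of $W^u$). Homoclinic points. $\mathcal H:=W^s\cap W^u$ (so $x\in\mathcal H$). For $p,q\in\mathcal H$ and $i\in\{s,u\}$, $[p,q]_i$ is the closed segment of $W^i$ between $p$ and $q$. The class $[p]\in\pi_1(M,x)$ is that of the loop running from $x$ through $[x,p]_u$ to $p$ and back through $[p,x]_s$ to $x$. $\mathcal H_{[x]}:=\{p\in\mathcal H: [p]=[x]\}$ is the set of contractible homoclinic points. Maslov index. For $p,q\in\mathcal H$ with $[p]=[q]$, the relative Maslov index $\mu(p,q)\in\mathbb Z$ is twice the winding number of the unit tangent vector along the (contractible) loop from $p$ through $[p,q]_u$ to $q$ and back through $[p,q]_s$ to $p$ (computed in the universal cover, with intersections made perpendicular, and turning by $+90^\circ$ at $q$ and by $-90^\circ$ at $p$). For $p\in\mathcal H_{[x]}$ put $\mu(p):=\mu(p,x)$, $\mu(x)=0$; then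 $\mu(p,q)=\mu(p)-\mu(q)$. Di-gons and signs. Let $\mathbb D\subset\mathbb R^2$ be a di-gon: a polygon with exactly two vertices $(-1,0)$ and $(1,0)$, both convex, with upper boundary arc $B_s$ and lower boundary arc $B_u$. For $\mu(p,q)=1$, $\mathcal M(p,q)$ is the space of smooth orientation preserving immersions $v:\mathbb D\to M$ (immersions also on boundary and vertices) with $v(B_u)\subset W^u$, $v(B_s)\subset W^s$, $v(-1,0)=p$, $v(1,0)=q$; $\widehat{\mathcal M}(p,q)$ is its quotient by orientation preserving diffeomorphisms of $\mathbb D$ fixing the vertices. Fix an orientation $o_u$ of $W^u$ and let $o_{pq}$ be the orientation of $[p,q]_u$ from $p$ to $q$. Set $n(p,q)=+1$ if $\widehat{\mathcal M}(p,q)\ne\emptyset$ and $o_{pq}=o_u$; $n(p,q)=-1$ if $\widehat{\mathcal M}(p,q)\neq\emptyset$ and $o_{pq}\ne o_u$; $n(p,q)=0$ if $\widehat{\mathcal M}(p,q)=\emptyset$. Chain groups and homology. $\mathcal E:=\{E\subseteq\mathcal H_{[x]}: |E|<\infty\}$. For $E\in\mathcal E$, $E_k:=\{p\in E:\mu(p)=k\}$, and $\mathbb Z E=\bigoplus_{k}\mathbb Z E_k$ is the free abelian group generated by $E$, graded by $\mu$ ($\mathbb Z\emptyset=0$). $\partial^E=(\partial^E_k)_k$, $\partial^E_k:\mathbb Z E_k\to\mathbb Z E_{k-1}$, is the linear map with $\partial^E_k p=\sum_{q\in E_{k-1}}n(p,q)\,q$ for $p\in E_k$. $E\in\mathcal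 E$ is called $\partial$-complete if $\partial^E\circ\partial^E=0$; $\overline{\mathcal E}:=\{E\in\mathcal E: E\ \partial\text{-complete}\}$, partially ordered by inclusion $\subseteq$. For $E\in\overline{\mathcal E}$, $H(E)=\bigoplus_k H_k(E)$ with $H_k(E)=\ker\partial^E_k/\operatorname{Im}\partial^E_{k+1}$. Chain compatibility. For $D\subseteq E$ in $\mathcal E$, $\mathcal I^{DE}=(\mathcal I^{DE}_k)_k:\mathbb Z D\to\mathbb Z E$ is the (graded) inclusion. For $D,E\in\overline{\mathcal E}$ with $D\subseteq E$, the pair $(D,E)$ is chain compatible if $\mathcal I^{DE}_{k-1}\circ\partial^D_k=\partial^E_k\circ\mathcal I^{DE}_k$ for all $k\in\mathbb Z$; in that case $H_k(\mathcal I^{DE}):H_k(D)\to H_k(E)$ and $H(\mathcal I^{DE}):H(D)\to H(E)$ denote the maps induced in homology. A subset $\tilde{\mathcal E}\subset\overline{\mathcal E}$ is chain compatible if $(D,E)$ is chain compatible for all $D,E\in\tilde{\mathcal E}$ with $D\subseteq E$. Direct systems. For a partially ordered set $(I,\preceq)$, a direct system in a category consists of objects $C^i$ ($i\in I$) and morphisms $\gamma^{ij}:C^i\to C^j$ ($i\preceq j$) with $\gamma^{ii}=\mathrm{Id}$ and $\gamma^{jk}\circ\gamma^{ij}=\gamma^{ik}$ for $i\preceq j\preceq k$; its direct limit $\varinjlim C^i$ is its colimit. A morphism of direct systems is a family of morphisms commuting with the transition maps; a sequence of direct systems of modules is short exact if it is so for each index $i$. $(I,\preceq)$ is directed if any two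 elements have a common upper bound in $I$. *)

(* Defs.v *)
From HB Require Import structures.
From mathcomp Require Import all_boot all_order all_algebra.
From mathcomp Require Import ring_quotient generic_quotient finmap.
From mathcomp Require Import all_classical all_reals all_analysis.
From mathcomp Require Import complex.

Set Implicit Arguments.
Unset Strict Implicit.
Unset Printing Implicit Defensive.

Import Order.TTheory GRing.Theory Num.Theory.
Import numFieldTopology.Exports numFieldNormedType.Exports.

Local Open Scope classical_set_scope.
Local Open Scope ring_scope.

Section Smoothness.
Context {R : realType}.

Fixpoint Ck_on {V W : normedModType R} (n : nat) (U : set V) (f : V -> W)
    : Prop :=
  match n with
  | 0%N => forall z, U z -> {for z, continuous f}
  | m.+1 => (forall z, U z -> differentiable f z) /\
            (forall v : V, Ck_on m U ('D_v f))
  end.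

(* To be used with an open set U. *)
Definition smooth_on {V W : normedModType R} (U : set V) (f : V -> W) : Prop :=
  forall n, Ck_on n U f.

End Smoothness.

Notation plane R := ('rV[R]_2).

Definition pt {R : realType} (a b : R) : plane R :=
  \row_(j < 2) (if j == 0 then a else b).
Definition xc {R : realType} (z : plane R) : R := z 0 0.
Definition yc {R : realType} (z : plane R) : R := z 0 1.

(* A Hausdorff space with a smooth atlas modelled on the plane.  The charts and
   their inverses are total functions, meaningful on [dom i] and on
   [chart i @` dom i] only. *)
Record surface (R : realType) := Surface {
  points :> topologicalType;
  chart_index : Type;
  dom : chart_index -> set points;
  chart : chart_index -> points -> plane R;
  chart_inv : chart_index -> plane R -> points;
  surface_hausdorff : hausdorff_space points;
  dom_open : forall i, open (dom i);
  dom_cover : forall m, exists i, dom i m;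
  cod_open : forall i, open (chart i @` dom i);
  chartK : forall i m, dom i m -> chart_inv i (chart i m) = m;
  chart_continuous : forall i m, dom i m -> {for m, continuous (chart i)};
  chart_inv_continuous :
    forall i z, (chart i @` dom i) z -> {for z, continuous (chart_inv i)};
  transition_smooth : forall i j,
    smooth_on (chart i @` (dom i `&` dom j)) (chart j \o chart_inv i)
}.

Arguments dom {R} s i.
Arguments chart {R} s i.
Arguments chart_inv {R} s i.

Section SmoothMaps.
Context {R : realType} (M : surface R).

Definition smooth_into {V : normedModType R} (U : set V) (f : V -> M) : Prop :=
  (forall z, U z -> {for z, continuous f}) /\
  forall i, smooth_on (U `&` f @^-1` dom M i) (chart M i \o f).

Definition smooth_from (f : M -> plane R) : Prop :=
  forall i, smooth_on (chart M i @` dom M i) (f \o chart_inv M i).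

Definition smooth_map (f : M -> M) : Prop :=
  continuous f /\
  forall i j, smooth_on (chart M i @` (dom M i `&` f @^-1` dom M j))
                        (chart M j \o f \o chart_inv M i).

Definition is_plane : Prop :=
  exists (f : plane R -> M) (g : M -> plane R),
    [/\ cancel f g, cancel g f, smooth_into setT f & smooth_from g].

Definition simple_closed_curve (c : R -> M) : Prop :=
  [/\ {within `[0, 1], continuous c}, c 0 = c 1 &
      {in `[0, 1[ &, injective c}].

(* [g] disjoint simple closed curves can be removed from M without
   disconnecting it; the genus of a closed orientable surface is the greatest
   such [g]. *)
Definition cuts (g : nat) : Prop :=
  exists c : 'I_g -> R -> M,
    [/\ forall a, simple_closed_curve (c a),
        forall a b, a != b -> (c a @` `[0, 1]) `&` (c b @` `[0, 1]) = set0 &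
        connected (~` \bigcup_(a in [set: 'I_g]) (c a @` `[0, 1]))].

Definition has_genus (g : nat) : Prop := cuts g /\ ~ cuts g.+1.

(* Orientability is not listed: it comes with the symplectic form. *)
Definition is_closed_surface (g : nat) : Prop :=
  [/\ compact [set: M], connected [set: M] & has_genus g].

(* In chart [i] the form is [density i] dx /\ dy; closedness is automatic in
   dimension two. *)
Record symplectic_form := SymplecticForm {
  density : chart_index M -> plane R -> R;
  density_smooth : forall i, smooth_on (chart M i @` dom M i) (density i);
  density_neq0 : forall i z, (chart M i @` dom M i) z -> density i z != 0;
  density_change : forall i j m, dom M i m -> dom M j m ->
    density i (chart M i m) =
    density j (chart M j m) *
      \det ('J (chart M j \o chart_inv M i) (chart M i m))
}.

Definition symplectomorphism (om : symplectic_form) (phi psi : M -> M) : Prop :=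
  [/\ cancel phi psi, cancel psi phi, smooth_map phi, smooth_map psi &
      forall i j m, dom M i m -> dom M j (phi m) ->
        density om i (chart M i m) =
        density om j (chart M j (phi m)) *
          \det ('J (chart M j \o phi \o chart_inv M i) (chart M i m))].

(* M carries the orientation in which the symplectic form is positive. *)
Definition oriented_immersion_at (om : symplectic_form) (v : plane R -> M)
    (z : plane R) : Prop :=
  forall i, dom M i (v z) ->
    0 < density om i (chart M i (v z)) * \det ('J (chart M i \o v) z).

Definition universal_cover (om : symplectic_form) (cov : plane R -> M) : Prop :=
  [/\ smooth_into setT cov,
      forall z, oriented_immersion_at om cov z,
      forall m, exists z, cov z = m &
      forall m, exists (V : set M) (sheets : set (set (plane R))),
        [/\ open V, V m, trivIset sheets id,
            cov @^-1` V = \bigcup_(O in sheets) O &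
            forall O, sheets O -> open O /\ set_bij O V cov]].

Definition loop_homotopic (a b : R -> M) : Prop :=
  exists F : R * R -> M,
    [/\ {within `[0, 1] `*` `[0, 1], continuous F},
        forall r, 0 <= r <= 1 -> F (r, 0) = a r /\ F (r, 1) = b r &
        forall t, 0 <= t <= 1 -> F (0, t) = a 0 /\ F (1, t) = a 1].

Definition immersed_curve (g : R -> M) : Prop :=
  smooth_into setT g /\
  forall t i, dom M i (g t) -> derive1 (chart M i \o g) t != 0.

End SmoothMaps.

(* [stable_curve] and [unstable_curve] parametrize the stable and the unstable
   manifold of [tangle_base].  The direction of increasing parameter on
   [unstable_curve] is the chosen orientation of the unstable manifold. *)
Record tangle (R : realType) := Tangle {
  surf :> surface R;
  tangle_form : symplectic_form surf;
  tangle_map : surf -> surf;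
  tangle_map_inv : surf -> surf;
  tangle_base : surf;
  stable_curve : R -> surf;
  unstable_curve : R -> surf
}.

Section Tangle.
Context {R : realType} (T : tangle R).
Local Notation x := (tangle_base T).
Local Notation gs := (stable_curve T).
Local Notation gu := (unstable_curve T).

Definition plane_or_closed_surface : Prop :=
  is_plane T \/ exists2 g : nat, (1 <= g)%N & is_closed_surface T g.

(* ['J] acts on row vectors; it is the transpose of the usual matrix of the
   differential, and has the same eigenvalues. *)
Definition hyperbolic_fixed_point : Prop :=
  tangle_map x = x /\
  forall i, dom T i x -> forall l : R[i],
    eigenvalue (map_mx (real_complex R)
      ('J (chart T i \o @tangle_map R T \o chart_inv T i) (chart T i x))) l ->
    `|l| != 1.

Definition Ws : set T :=
  [set p | (iter n (@tangle_map R T) p) @[n --> \oo] --> x].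
Definition Wu : set T :=
  [set p | (iter n (@tangle_map_inv R T) p) @[n --> \oo] --> x].

Definition parametrizes (g : R -> T) (W : set T) : Prop :=
  [/\ immersed_curve g, injective g, range g = W & g 0 = x].

Definition transverse : Prop :=
  forall s t i, gs s = gu t -> dom T i (gs s) ->
    \det (col_mx (derive1 (chart T i \o gs) s) (derive1 (chart T i \o gu) t)
          : 'M[R]_2) != 0.

Definition branch (g : R -> T) (positive : bool) : set T :=
  g @` [set t | if positive then 0 < t else t < 0].

Definition strongly_intersecting : Prop :=
  forall b c : bool, branch gu b `&` branch gs c !=set0.

Definition preserves_orientation (g : R -> T) : Prop :=
  exists2 h : R -> R, {homo h : a b / a < b} & forall t, tangle_map (g t) = g (h t).

Definition W_orientation_preserving : Prop :=
  preserves_orientation gs /\ preserves_orientation gu.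

Definition homoclinic : set T := Ws `&` Wu.

Definition param (g : R -> T) (p : T) : R := xget 0 [set t | g t = p].

(* From the base point to [p] along the unstable manifold, and back along the
   stable manifold. *)
Definition homoclinic_loop (p : T) (r : R) : T :=
  if r <= 2^-1 then gu (2 * r * param gu p)
  else gs (2 * (1 - r) * param gs p).

Definition same_class (p q : T) : Prop :=
  loop_homotopic (homoclinic_loop p) (homoclinic_loop q).

Definition contractible_homoclinic : set T :=
  [set p | homoclinic p /\ same_class p x].

Definition is_lift (cov : plane R -> T) (g : R -> T) (a : R -> plane R) : Prop :=
  continuous a /\ forall t, cov (a t) = g t.

Definition tangent_angle (a : R -> plane R) (th : R -> R) : Prop :=
  continuous th /\
  forall t, exists2 r : R, 0 < r & derive1 a t = r *: pt (cos (th t)) (sin (th t)).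

(* [al] is the angle in ]0, pi[ by which a line of direction [thu] has to be
   turned to become a line of direction [ths]. *)
Definition crossing_angle (thu ths al : R) : Prop :=
  0 < al < pi /\ exists k : int, ths = thu + al + k%:~R * pi.

(* [m] is twice the winding number of the tangent direction along the lift of
   the loop that runs from p to q along the unstable manifold and back along the
   stable one.  Making the crossings perpendicular rotates the stable tangent
   line at an end point of the segment from its angle [al] with the unstable
   line to [pi / 2], through angles in ]0, pi[.  Reversing the direction in
   which a segment is run through shifts its tangent angle by a constant, so
   [thu] and [ths] can be used whatever that direction. *)
Definition maslov_spec (p q : T) (m : int) : Prop :=
  let: (up, uq) := (param gu p, param gu q) in
  let: (sp, sq) := (param gs p, param gs q) in
  exists (cov : plane R -> T) (a b : R -> plane R) (thu ths : R -> R)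
         (alp alq : R),
    let ths_perp s al := ths s + (pi / 2 - al) in
    let turning := (thu uq - thu up) + pi / 2
                   + (ths_perp sp alp - ths_perp sq alq) - pi / 2 in
    [/\ universal_cover (tangle_form T) cov,
        is_lift cov gu a /\ is_lift cov gs b,
        a up = b sp /\ a uq = b sq,
        tangent_angle a thu /\ tangent_angle b ths &
        [/\ crossing_angle (thu up) (ths sp) alp,
            crossing_angle (thu uq) (ths sq) alq &
            m%:~R = 2 * (turning / (2 * pi))]].

Definition maslov (p q : T) : int := xget 0 (maslov_spec p q).

(* The di-gon is the lens bounded by the parabolas 2 y = +/- (1 - x ^ 2). *)
Definition digon : set (plane R) := [set z | 2 * `|yc z| <= 1 - xc z ^+ 2].
Definition digon_s : set (plane R) := digon `&` [set z | 0 <= yc z /\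
  2 * yc z = 1 - xc z ^+ 2].
Definition digon_u : set (plane R) := digon `&` [set z | yc z <= 0 /\
  2 * yc z = - (1 - xc z ^+ 2)].

(* A map on the di-gon is given by a total function, whose values off the
   di-gon are ignored by [digon_equiv]; smoothness on the closed di-gon means
   agreeing there with a smooth map of a neighbourhood. *)
Definition digon_immersion (p q : T) (v : plane R -> T) : Prop :=
  (exists (O : set (plane R)) (w : plane R -> T),
     [/\ open O, digon `<=` O, smooth_into O w, {in digon, v =1 w} &
         forall z, digon z -> oriented_immersion_at (tangle_form T) w z]) /\
  [/\ v @` digon_u `<=` Wu, v @` digon_s `<=` Ws,
      v (pt (-1) 0) = p & v (pt 1 0) = q].

Definition digon_smooth (f : plane R -> plane R) : Prop :=
  exists2 O : set (plane R), open O & digon `<=` O /\ smooth_on O f.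

Definition digon_diffeo (f : plane R -> plane R) : Prop :=
  [/\ digon_smooth f, set_bij digon digon f,
      (exists2 g, digon_smooth g & {in digon, cancel f g}),
      forall z, digon z -> 0 < \det ('J f z) &
      f (pt (-1) 0) = pt (-1) 0 /\ f (pt 1 0) = pt 1 0].

Definition digon_equiv (v w : plane R -> T) : Prop :=
  exists2 f, digon_diffeo f & {in digon, w =1 v \o f}.

Definition digon_moduli (p q : T) : set (set (plane R -> T)) :=
  [set C | exists2 v, digon_immersion p q v &
           C = [set w | digon_immersion p q w /\ digon_equiv v w]].

Definition signed_count (p q : T) : int :=
  if `[< digon_moduli p q !=set0 >] then
    (if param gu p < param gu q then 1 else -1)
  else 0.

End Tangle.

Arguments tangle_map {R} t _.
Arguments tangle_map_inv {R} t _.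
Arguments Ws {R} T _.
Arguments Wu {R} T _.
Arguments homoclinic {R} T _.
Arguments contractible_homoclinic {R} T _.

Section ContractiblePoints.
Context {R : realType} (T : tangle R).

Definition contractible_point : choiceType :=
  set_type (contractible_homoclinic T).

Definition homoclinic_degree (p : contractible_point) : int :=
  maslov (val p) (tangle_base T).

Definition digon_sign (p q : contractible_point) : int :=
  signed_count (val p) (val q).

End ContractiblePoints.

Arguments homoclinic_degree {R} T p.
Arguments digon_sign {R} T p q.

(* A Z-module is a [zmodType]: the scalar action of Z is [*~], and additive maps
   commute with it. *)

Section Chains.
Context {K : choiceType} (mu : K -> int) (n : K -> K -> int).

Definition degree_part (E : {fset K}) (k : int) : {fset K} :=
  [fset p in E | mu p == k]%fset.

(* The free abelian group on the (finite) set [degree_part E k]. *)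
Definition chains (E : {fset K}) (k : int) := {ffun degree_part E k -> int}.

HB.instance Definition _ E k := GRing.Zmodule.on (chains E k).

(* The boundary operator of degree k is [boundary E k (k - 1)].  The target
   degree is a separate argument because [k + 1 - 1] and [k] are different
   indices of the dependent family [chains E]. *)
Definition boundary (E : {fset K}) (k l : int) (c : chains E k) : chains E l :=
  [ffun q : degree_part E l => \sum_(p : degree_part E k) c p * n (val p) (val q)].

Fact boundary_is_zmod_morphism E k l : zmod_morphism (@boundary E k l).
Proof.
move=> a b; apply/ffunP => q; rewrite !ffunE -sumrB.
by apply: eq_bigr => p _; rewrite !ffunE mulrBl.
Qed.

HB.instance Definition _ E k l :=
  GRing.isZmodMorphism.Build (chains E k) (chains E l) (@boundary E k l)
    (@boundary_is_zmod_morphism E k l).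

Definition boundary_complete (E : {fset K}) : Prop :=
  forall k (c : chains E k),
    boundary (k - 1 - 1) (boundary (k - 1) c) = 0.

Definition is_cycle E k : {pred chains E k} :=
  [pred c | boundary (k - 1) c == 0].

Fact is_cycle_zmod_closed E k : zmod_closed (@is_cycle E k).
Proof.
split=> [|a b]; rewrite !inE ?raddf0 // => /eqP a0 /eqP b0.
by rewrite raddfB /= a0 b0 subrr.
Qed.

HB.instance Definition _ E k :=
  GRing.isZmodClosed.Build (chains E k) (@is_cycle E k)
    (@is_cycle_zmod_closed E k).

Record cycles (E : {fset K}) (k : int) :=
  Cycle { cycle_val :> chains E k; _ : cycle_val \in @is_cycle E k }.

HB.instance Definition _ E k := [isSub for @cycle_val E k].
HB.instance Definition _ E k := [Choice of cycles E k by <:].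
HB.instance Definition _ E k := [SubChoice_isSubZmodule of cycles E k by <:].

Definition is_boundary E k : {pred cycles E k} :=
  [pred z | `[< exists b : chains E (k + 1), boundary k b = val z >]].

Fact is_boundary_zmod_closed E k : zmod_closed (@is_boundary E k).
Proof.
split=> [|a b].
  by rewrite /is_boundary unfold_in; apply/asboolP; exists 0; rewrite !raddf0.
rewrite /is_boundary !unfold_in => /asboolP[c cE] /asboolP[d dE].
by apply/asboolP; exists (c - d); rewrite !raddfB /= cE dE.
Qed.

HB.instance Definition _ E k :=
  GRing.isZmodClosed.Build (cycles E k) (@is_boundary E k)
    (@is_boundary_zmod_closed E k).

Definition homology (E : {fset K}) (k : int) := {ideal_quot @is_boundary E k}.

HB.instance Definition _ E k := GRing.Zmodule.on (homology E k).
HB.instance Definition _ E k := EqQuotient.on (homology E k).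

Definition hclass E k (z : cycles E k) : homology E k :=
  (\pi_(homology E k) z)%qT.

Definition inclusion (D E : {fset K}) (k : int) (c : chains D k) : chains E k :=
  [ffun q : degree_part E k => \sum_(p : degree_part D k | val p == val q) c p].

Fact inclusion_is_zmod_morphism D E k : zmod_morphism (@inclusion D E k).
Proof.
move=> a b; apply/ffunP => q; rewrite !ffunE -sumrB.
by apply: eq_bigr => p _; rewrite !ffunE.
Qed.

HB.instance Definition _ D E k :=
  GRing.isZmodMorphism.Build (chains D k) (chains E k) (@inclusion D E k)
    (@inclusion_is_zmod_morphism D E k).

End Chains.

Section ChainCompatibility.
Context {K : choiceType} (mu : K -> int) (n : K -> K -> int).

Definition chain_compatible_pair (D E : {fset K}) : Prop :=
  forall k (c : chains mu D k),
    inclusion E (boundary n (k - 1) c) = boundary n (k - 1) (inclusion E c).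

Definition chain_compatible (Et : set {fset K}) : Prop :=
  forall D E, Et D -> Et E -> (D `<=` E)%fset -> chain_compatible_pair D E.

Section InducedMap.
Variables (D E : {fset K}) (DE : chain_compatible_pair D E).

Fact inclusion_boundary k l (c : chains mu D k) : l = k - 1 ->
  inclusion E (boundary n l c) = boundary n l (inclusion E c).
Proof. by move=> ->; exact: DE. Qed.

Fact inclusion_cycle k (z : cycles mu n D k) :
  inclusion E (val z) \in @is_cycle K mu n E k.
Proof.
case: z => c /= /eqP c0.
by rewrite unfold_in /= -DE c0 raddf0.
Qed.

Definition induced_cycle k (z : cycles mu n D k) : cycles mu n E k :=
  Cycle (inclusion_cycle z).

Definition homology_map k (a : homology mu n D k) : homology mu n E k :=
  hclass (induced_cycle (repr a)).

Fact hclassB F k : {morph @hclass K mu n F k : a b / a - b}.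
Proof. by move=> a b; rewrite /hclass raddfB. Qed.

Fact eq_hclass F k (a b : cycles mu n F k) :
  hclass a = hclass b <->
  exists c : chains mu F (k + 1), boundary n k c = val a - val b.
Proof.
transitivity (a - b \in @is_boundary K mu n F k).
  by rewrite Quotient.idealrBE; split=> [e|/eqP]; first exact/eqP.
by rewrite /is_boundary unfold_in raddfB; split=> /asboolP.
Qed.

Lemma homology_mapE k (z : cycles mu n D k) (w : cycles mu n E k) :
  val w = inclusion E (val z) -> homology_map (hclass z) = hclass w.
Proof.
move=> wz; apply/eq_hclass.
have /eq_hclass[c cE] : hclass (repr (hclass z)) = hclass z by exact: reprK.
exists (inclusion E c).
by rewrite -inclusion_boundary ?addrK// cE raddfB /= wz.
Qed.

Fact homology_map_is_zmod_morphism k : zmod_morphism (@homology_map k).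
Proof.
move=> a b; rewrite -[a]reprK -[b]reprK.
rewrite -[\pi%qT (repr a)]/(hclass (repr a)) -[\pi%qT (repr b)]/(hclass (repr b)).
rewrite -hclassB !(homology_mapE (w := induced_cycle _) (erefl _)) -hclassB.
by congr hclass; apply: val_inj; rewrite /= !raddfB.
Qed.

HB.instance Definition _ k :=
  GRing.isZmodMorphism.Build (homology mu n D k) (homology mu n E k)
    (@homology_map k) (@homology_map_is_zmod_morphism k).

End InducedMap.
End ChainCompatibility.

Section DirectSum.
Context {I : choiceType} (F : I -> zmodType).

Record dsum := DSum {
  dsum_val :> forall i, F i;
  dsum_finite : finite_set [set i | dsum_val i != 0]
}.

HB.instance Definition _ := gen_eqMixin dsum.
HB.instance Definition _ := gen_choiceMixin dsum.

Fact dsum_eq (a b : dsum) : (forall i, a i = b i) -> a = b.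
Proof.
case: a b => [a af] [b bf] /= ab.
have eab : a = b by exact: functional_extensionality_dep.
by case: _ / eab bf {ab} => bf; congr DSum; exact: Prop_irrelevance.
Qed.

Fact dsum0_finite : finite_set [set i | (0 : F i) != 0].
Proof.
by rewrite (_ : mkset _ = set0) //; apply/seteqP; split=> i //=; rewrite eqxx.
Qed.

Fact dsumN_finite (a : dsum) : finite_set [set i | - a i != 0].
Proof.
apply: sub_finite_set (dsum_finite a) => i /=; by rewrite oppr_eq0.
Qed.

Fact dsumD_finite (a b : dsum) : finite_set [set i | a i + b i != 0].
Proof.
apply: (@sub_finite_set _ _ ([set i | a i != 0] `|` [set i | b i != 0])).
  move=> i /=; have [->|] := eqVneq (a i) 0; last by left.
  by rewrite add0r; right.
by rewrite finite_setU; split; exact: dsum_finite.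
Qed.

Definition dsum0 := DSum dsum0_finite.
Definition dsumN a := DSum (dsumN_finite a).
Definition dsumD a b := DSum (dsumD_finite a b).

Fact dsumDA : associative dsumD.
Proof. by move=> a b c; apply: dsum_eq => i; exact: addrA. Qed.
Fact dsumDC : commutative dsumD.
Proof. by move=> a b; apply: dsum_eq => i; exact: addrC. Qed.
Fact dsum0D : left_id dsum0 dsumD.
Proof. by move=> a; apply: dsum_eq => i; exact: add0r. Qed.
Fact dsumND : left_inverse dsum0 dsumN dsumD.
Proof. by move=> a; apply: dsum_eq => i; exact: addNr. Qed.

HB.instance Definition _ := GRing.isZmodule.Build dsum dsumDA dsumDC dsum0D dsumND.

Definition dsum_degree (k : I) : set dsum :=
  [set a | forall l, l != k -> a l = 0].

End DirectSum.

Section DirectSumMap.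
Context {I : choiceType} (F G : I -> zmodType).
Variable f : forall i, {additive F i -> G i}.

Fact dsum_map_finite (a : dsum F) : finite_set [set i | f i (a i) != 0].
Proof.
apply: sub_finite_set (dsum_finite a) => i /=.
by apply: contra_neq => ->; rewrite raddf0.
Qed.

Definition dsum_map (a : dsum F) : dsum G := DSum (dsum_map_finite a).

Fact dsum_map_is_zmod_morphism : zmod_morphism dsum_map.
Proof. by move=> a b; apply: dsum_eq => i; exact: raddfB. Qed.

HB.instance Definition _ :=
  GRing.isZmodMorphism.Build (dsum F) (dsum G) dsum_map dsum_map_is_zmod_morphism.

End DirectSumMap.

Section DirectSystems.
Context {d : Order.disp_t} {I : porderType d}.

Record dsystem := DSystem {
  dobj :> I -> zmodType;
  dtrans : forall i j, (i <= j)%O -> {additive dobj i -> dobj j}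
}.

Definition is_direct_system (S : dsystem) : Prop :=
  (forall i (ii : (i <= i)%O) (a : S i), dtrans S ii a = a) /\
  (forall i j k (ij : (i <= j)%O) (jk : (j <= k)%O) (ik : (i <= k)%O) (a : S i),
     dtrans S jk (dtrans S ij a) = dtrans S ik a).

(* X is the internal direct sum of the subgroups [G k]. *)
Definition is_grading (X : zmodType) (G : int -> set X) : Prop :=
  [/\ forall k, G k 0 /\ (forall a b, G k a -> G k b -> G k (a - b)),
      forall a, exists (s : seq int) (c : int -> X),
        (forall k, G k (c k)) /\ a = \sum_(k <- s) c k &
      forall (s : seq int) (c : int -> X), uniq s -> (forall k, G k (c k)) ->
        \sum_(k <- s) c k = 0 -> forall k, k \in s -> c k = 0].

Definition is_graded_system (S : dsystem) (G : forall i, int -> set (S i)) : Prop :=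
  [/\ is_direct_system S,
      forall i, is_grading (G i) &
      forall i j (ij : (i <= j)%O) k a, G i k a -> G j k (dtrans S ij a)].

Definition is_cocone (S : dsystem) (L : zmodType)
    (t : forall i, {additive S i -> L}) : Prop :=
  forall i j (ij : (i <= j)%O) a, t j (dtrans S ij a) = t i a.

Definition is_direct_limit (S : dsystem) (L : zmodType)
    (iota : forall i, {additive S i -> L}) : Prop :=
  is_cocone iota /\
  forall (X : zmodType) (t : forall i, {additive S i -> X}), is_cocone t ->
    exists2 u : {additive L -> X}, (forall i a, u (iota i a) = t i a) &
      forall v : {additive L -> X}, (forall i a, v (iota i a) = t i a) -> v =1 u.

Definition has_direct_limit (S : dsystem) : Prop :=
  exists (L : zmodType) (iota : forall i, {additive S i -> L}),
    is_direct_limit iota.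

Definition is_system_morphism (S S' : dsystem)
    (f : forall i, {additive S i -> S' i}) : Prop :=
  forall i j (ij : (i <= j)%O) a, f j (dtrans S ij a) = dtrans S' ij (f i a).

Definition short_exact (A B C : zmodType) (f : A -> B) (g : B -> C) : Prop :=
  [/\ injective f, forall b, g b = 0 <-> exists a, f a = b &
      forall c, exists b, g b = c].

Definition limits_preserve_exactness (S : dsystem) : Prop :=
  forall (A B C : dsystem)
    (f : forall i, {additive A i -> B i}) (g : forall i, {additive B i -> C i}),
  is_direct_system A -> is_direct_system B -> is_direct_system C ->
  is_system_morphism f -> is_system_morphism g ->
  (forall i, short_exact (f i) (g i)) ->
  A = S \/ B = S \/ C = S ->
  forall (LA LB LC : zmodType)
    (ia : forall i, {additive A i -> LA}) (ib : forall i, {additive B i -> LB})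
    (ic : forall i, {additive C i -> LC}),
  is_direct_limit ia -> is_direct_limit ib -> is_direct_limit ic ->
  exists (lf : {additive LA -> LB}) (lg : {additive LB -> LC}),
    [/\ forall i a, lf (ia i a) = ib i (f i a),
        forall i b, lg (ib i b) = ic i (g i b) &
        short_exact lf lg].

Definition directed : Prop :=
  forall i j : I, exists k : I, (i <= k)%O /\ (j <= k)%O.

End DirectSystems.

Arguments dsystem {d} I.
Arguments directed {d} I.
Arguments is_graded_system {d I} S G.
Arguments is_direct_system {d I} S.

Definition fset_family {K : choiceType} (Et : set {fset K}) : Type := set_type Et.

Section Family.
Context {K : choiceType} (Et : set {fset K}).

HB.instance Definition _ := SubChoice.on (fset_family Et).

Definition family_le (D E : fset_family Et) : bool := (val D `<=` val E)%fset.

Fact family_le_refl : reflexive family_le.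
Proof. by move=> D; exact: fsubset_refl. Qed.
Fact family_le_anti : antisymmetric family_le.
Proof. by move=> D E /andP[DE ED]; apply/val_inj/eqP; rewrite eqEfsubset; apply/andP. Qed.
Fact family_le_trans : transitive family_le.
Proof. by move=> D E F; exact: fsubset_trans. Qed.

Fact family_display : Order.disp_t. Proof. exact: Order.Disp tt tt. Qed.

HB.instance Definition _ := Order.Le_isPOrder.Build family_display (fset_family Et)
  family_le_refl family_le_anti family_le_trans.

End Family.

Section HomologySystems.
Context {K : choiceType} {mu : K -> int} {n : K -> K -> int} {Et : set {fset K}}.
Hypothesis compat : chain_compatible mu n Et.

Fact family_compatible (D E : fset_family Et) :
  (D <= E)%O -> chain_compatible_pair mu n (val D) (val E).
Proof. by move=> DE; apply: compat => //; exact/set_mem/valP. Qed.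

Definition homology_system (k : int) : dsystem (fset_family Et) :=
  {| dobj := fun D : fset_family Et => homology mu n (val D) k;
     dtrans := fun D E DE => homology_map (family_compatible DE) (k:=k) |}.

Definition total_homology_system : dsystem (fset_family Et) :=
  {| dobj := fun D : fset_family Et => dsum (homology mu n (val D));
     dtrans := fun D E DE =>
       dsum_map (fun k => homology_map (family_compatible DE) (k := k)) |}.

Definition concentrated (k : int) (D : fset_family Et) (l : int)
    : set (homology_system k D) := [set a | l = k \/ a = 0].

Definition total_degree (D : fset_family Et) (l : int)
    : set (total_homology_system D) := @dsum_degree int (homology mu n (val D)) l.

Definition is_limit_homology (L : int -> zmodType)
    (iota : forall k (D : fset_family Et), {additive homology_system k D -> L k}) : Prop :=
  forall k, is_direct_limit (iota k).

(* The limits [L k] exist and are unique up to a unique isomorphism compatible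
   with the canonical maps; the resulting isomorphism of the direct sums
   [dsum L] is the total one. *)
Definition limit_homology_well_defined : Prop :=
  (exists (L : int -> zmodType)
     (iota : forall k (D : fset_family Et), {additive homology_system k D -> L k}),
     is_limit_homology iota) /\
  (forall (L L' : int -> zmodType)
     (iota : forall k (D : fset_family Et), {additive homology_system k D -> L k})
     (iota' : forall k (D : fset_family Et), {additive homology_system k D -> L' k}),
     is_limit_homology iota -> is_limit_homology iota' ->
     exists theta : forall k, {additive L k -> L' k},
       [/\ forall k D a, theta k (iota k D a) = iota' k D a,
           forall k (v : {additive L k -> L' k}),
             (forall D a, v (iota k D a) = iota' k D a) -> v =1 theta k,
           forall k, bijective (theta k) &
           bijective (dsum_map theta)]).

End HomologySystems.

Arguments concentrated {K mu n Et} compat k D l _.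
Arguments total_degree {K mu n Et} compat D l _.

(* Main.v *)
From HB Require Import structures.
Require Import Defs.
From mathcomp Require Import all_boot all_order all_algebra finmap.
From mathcomp Require Import ring_quotient generic_quotient.
From mathcomp Require Import all_classical all_reals all_analysis.

Set Implicit Arguments.
Unset Strict Implicit.
Unset Printing Implicit Defensive.

Import Order.TTheory GRing.Theory.

Local Open Scope classical_set_scope.
Local Open Scope ring_scope.

(** Geometry enters through the integers [homoclinic_degree] and [digon_sign]
    alone: the argument is algebraic, and works for any integer degrees and
    signs on a set of generators. The inclusions of chain groups are functorial
    on the nose ([inclusion_id], [inclusion_comp]), and for a chain compatible
    family they are chain maps, so homology is a direct system, degree by degree
    and hence in total.

    Every direct system of abelian groups, over any partially ordered set, has
    a direct limit. Take formal sums of elements of the groups of the system,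
    and identify two of them when every cocone gives them the same value
    ([colimit]). With this impredicative choice of the relation the universal
    property holds almost by definition: a cocone descends because equivalent
    sums have equal values, and the induced map is unique because the classes of
    one-term sums generate.

    Over a directed index set two facts hold in any direct limit, whatever its
    construction: each element comes from a single index or is zero
    ([direct_limit_surj]), and an element of one group of the system that
    vanishes in the limit already vanishes at some later index
    ([direct_limit_eq0]). The second is obtained from the universal property by
    exhibiting one cocone that detects it: an element [a] at index [i] is sent to
    its tail, the family of its images at the indices above [i], in the product
    of all groups modulo families that are eventually zero. Exactness of the
    limit sequence is then a diagram chase at a sufficiently late index
    ([directed_limits_preserve_exactness]).

    Well-definedness of the limit homology is uniqueness of the objects that
    satisfy the universal property ([direct_limit_iso]). *)

(** * Direct limits over an arbitrary partially ordered set *)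

Section Colimit.
Context {d : Order.disp_t} {I : porderType d} (S : dsystem I).

Definition formal_sum : Type := seq {i : I & S i : Type}.

HB.instance Definition _ := gen_eqMixin formal_sum.
HB.instance Definition _ := gen_choiceMixin formal_sum.

Definition formal_eval (X : zmodType) (t : forall i, {additive S i -> X})
    (w : formal_sum) : X :=
  \sum_(u <- w) t (tag u) (tagged u).

Definition formal_opp (w : formal_sum) : formal_sum :=
  [seq existT (fun i => S i : Type) (tag u) (- tagged u : S (tag u)) | u <- w].

Lemma formal_eval_cat (X : zmodType) (t : forall i, {additive S i -> X}) v w :
  formal_eval t (v ++ w) = formal_eval t v + formal_eval t w.
Proof. exact: big_cat. Qed.

Lemma formal_eval_opp (X : zmodType) (t : forall i, {additive S i -> X}) w :
  formal_eval t (formal_opp w) = - formal_eval t w.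
Proof.
rewrite /formal_eval big_map -sumrN; apply: eq_bigr => u _; exact: raddfN.
Qed.

(** The coarsest identification that every cocone respects. It is the
    relation generated by the transition maps and the group laws, without a
    description of the generation. *)
Definition colimit_equiv (v w : formal_sum) : bool :=
  `[< forall (X : zmodType) (t : forall i, {additive S i -> X}),
        is_cocone t -> formal_eval t v = formal_eval t w >].

Fact colimit_equiv_class : equiv_class_of colimit_equiv.
Proof.
split=> [w|v w|v u w]; first exact/asboolP.
  by apply/asboolP/asboolP => vw X t tS; rewrite vw.
move=> /asboolP vu /asboolP uw; apply/asboolP => X t tS.
by rewrite vu // uw.
Qed.

Canonical colimit_equiv_rel := EquivRelPack colimit_equiv_class.

Definition colimit := {eq_quot colimit_equiv_rel}%qT.

HB.instance Definition _ := Choice.on colimit.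
HB.instance Definition _ := EqQuotient.on colimit.

Definition colimit_class (w : formal_sum) : colimit := (\pi_colimit w)%qT.

Lemma colimit_classP v w :
  colimit_class v = colimit_class w <->
  forall (X : zmodType) (t : forall i, {additive S i -> X}),
    is_cocone t -> formal_eval t v = formal_eval t w.
Proof.
split; first by move=> /eqquotP /asboolP.
by move=> vw; apply/eqquotP/asboolP.
Qed.

Definition colimit0 : colimit := colimit_class [::].
Definition colimitN (a : colimit) : colimit := colimit_class (formal_opp (repr a)).
Definition colimitD (a b : colimit) : colimit :=
  colimit_class ((repr a : formal_sum) ++ repr b).

Lemma colimit_repr_eval (X : zmodType) (t : forall i, {additive S i -> X}) w :
  is_cocone t -> formal_eval t (repr (colimit_class w)) = formal_eval t w.
Proof.
by move=> tS; apply/colimit_classP: X t tS; exact: reprK.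
Qed.

Fact colimitDA : associative colimitD.
Proof.
move=> a b c; apply/colimit_classP => X t tS.
by rewrite !(formal_eval_cat, colimit_repr_eval) // addrA.
Qed.

Fact colimitDC : commutative colimitD.
Proof.
by move=> a b; apply/colimit_classP => X t _; rewrite !formal_eval_cat addrC.
Qed.

Fact colimit0D : left_id colimit0 colimitD.
Proof.
move=> a; rewrite -[RHS]reprK; apply/colimit_classP => X t tS.
by rewrite formal_eval_cat colimit_repr_eval // /formal_eval big_nil add0r.
Qed.

Fact colimitND : left_inverse colimit0 colimitN colimitD.
Proof.
move=> a; apply/colimit_classP => X t tS.
rewrite formal_eval_cat colimit_repr_eval // formal_eval_opp addNr.
by rewrite /formal_eval big_nil.
Qed.

HB.instance Definition _ :=
  GRing.isZmodule.Build colimit colimitDA colimitDC colimit0D colimitND.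

Definition colimit_in i (a : S i) : colimit :=
  colimit_class [:: existT (fun i => S i : Type) i a].

Fact colimit_in_is_zmod_morphism i : zmod_morphism (@colimit_in i).
Proof.
move=> a b; apply/colimit_classP => X t tS.
rewrite formal_eval_cat !colimit_repr_eval // formal_eval_opp colimit_repr_eval //.
by rewrite /formal_eval !big_seq1 /= raddfB.
Qed.

HB.instance Definition _ i :=
  GRing.isZmodMorphism.Build (S i) colimit (@colimit_in i)
    (@colimit_in_is_zmod_morphism i).

Section Descent.
Context (X : zmodType) (t : forall i, {additive S i -> X}) (tS : is_cocone t).

(* The cocone property is an argument of the map, so that its additivity can be
   registered as a canonical instance. *)
Definition colimit_desc of is_cocone t := fun a : colimit => formal_eval t (repr a).

Fact colimit_desc_is_zmod_morphism : zmod_morphism (colimit_desc tS).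
Proof.
move=> a b; rewrite /colimit_desc colimit_repr_eval // formal_eval_cat.
by rewrite colimit_repr_eval // formal_eval_opp.
Qed.

HB.instance Definition _ :=
  GRing.isZmodMorphism.Build colimit X (colimit_desc tS)
    colimit_desc_is_zmod_morphism.

Lemma colimit_desc_in i (a : S i) : colimit_desc tS (colimit_in a) = t i a.
Proof. by rewrite /colimit_desc colimit_repr_eval // /formal_eval big_seq1. Qed.

End Descent.

Lemma colimit_in_cocone : is_cocone (fun i => colimit_in (i := i) : {additive S i -> colimit}).
Proof.
move=> i j ij a; apply/colimit_classP => X t tS.
by rewrite /formal_eval !big_seq1 /=.
Qed.

(** This is what makes the map induced by a cocone unique. *)
Lemma colimit_generated (x : colimit) :
  x = formal_eval (fun i => colimit_in (i := i) : {additive S i -> colimit}) (repr x).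
Proof.
rewrite -[LHS]reprK; elim: (repr x : formal_sum) => [|[i a] w IH].
  by rewrite /formal_eval big_nil.
rewrite /formal_eval big_cons -[\sum_(_ <- _) _]IH.
apply/colimit_classP => X t tS.
rewrite formal_eval_cat !colimit_repr_eval // -formal_eval_cat.
exact: erefl.
Qed.

Lemma colimit_is_direct_limit :
  is_direct_limit (fun i => colimit_in (i := i) : {additive S i -> colimit}).
Proof.
split; first exact: colimit_in_cocone.
move=> X t tS; exists (colimit_desc tS); first by move=> i a; exact: colimit_desc_in.
move=> v vt x; rewrite [x]colimit_generated /formal_eval !raddf_sum.
by apply: eq_bigr => u _; rewrite vt -(colimit_desc_in tS).
Qed.

End Colimit.

Section LimitTheory.
Context {d : Order.disp_t} {I : porderType d} (S : dsystem I).

Lemma direct_limit_endo_id (L : zmodType) (iota : forall i, {additive S i -> L})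
    (v : {additive L -> L}) :
  is_direct_limit iota -> (forall i a, v (iota i a) = iota i a) -> v =1 id.
Proof.
move=> [iotaS univ] viota x; have [u _ uniq_u] := univ L iota iotaS.
by rewrite uniq_u // -(uniq_u (idfun : {additive L -> L})).
Qed.

(** The concrete colimit maps to [L] and back; the composite is an
    endomorphism of [L] compatible with [iota], hence the identity. So the
    generation of the concrete colimit transfers to [L]. *)
Lemma direct_limit_generated (L : zmodType) (iota : forall i, {additive S i -> L})
    (x : L) :
  is_direct_limit iota -> exists w : formal_sum S, x = formal_eval iota w.
Proof.
move=> lim; have [iotaS univ] := lim.
have [v viota _] := univ _ _ (@colimit_in_cocone _ _ S).
exists (repr (v x)).
rewrite -[LHS](direct_limit_endo_id (v := colimit_desc iotaS \o v) lim) //.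
by move=> i a /=; rewrite viota; exact: colimit_desc_in.
Qed.

(** Two summands living at different indices can be transported to a common
    upper bound and added there. The alternative [x = 0] covers the empty index
    set, which is directed in the sense used here. *)
Lemma direct_limit_surj (dirI : directed I) (L : zmodType)
    (iota : forall i, {additive S i -> L}) (x : L) :
  is_direct_limit iota -> x = 0 \/ exists i a, x = iota i a.
Proof.
move=> lim; have [w ->] := direct_limit_generated x lim.
rewrite /formal_eval; elim: w => [|[i a] w IH]; first by left; rewrite big_nil.
right; rewrite big_cons /=; case: IH => [->|[j [b ->]]].
  by exists i, a; rewrite addr0.
have [k [ik jk]] := dirI i j.
by exists k, (dtrans S ik a + dtrans S jk b); rewrite raddfD /= !lim.1.
Qed.

Lemma direct_limit_iso (L L' : zmodType) (iota : forall i, {additive S i -> L})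
    (iota' : forall i, {additive S i -> L'}) :
  is_direct_limit iota -> is_direct_limit iota' ->
  exists (u : {additive L -> L'}) (v : {additive L' -> L}),
    [/\ forall i a, u (iota i a) = iota' i a,
        forall w : {additive L -> L'},
          (forall i a, w (iota i a) = iota' i a) -> w =1 u,
        cancel u v & cancel v u].
Proof.
move=> lim lim'.
have [u uE u_uniq] := lim.2 _ _ lim'.1.
have [v vE _] := lim'.2 _ _ lim.1.
exists u, v; split => //.
  apply: (direct_limit_endo_id (v := v \o u) lim) => i a /=.
  by rewrite uE vE.
apply: (direct_limit_endo_id (v := u \o v) lim') => i a /=.
by rewrite vE uE.
Qed.

End LimitTheory.

(** * Eventual vanishing over a directed set *)

Section EventuallyZero.
Context {d : Order.disp_t} {I : porderType d} (F : I -> zmodType).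

Definition family : Type := forall i, F i.

HB.instance Definition _ := gen_eqMixin family.
HB.instance Definition _ := gen_choiceMixin family.

Fact familyDA : associative (fun a b : family => (fun i => a i + b i) : family).
Proof. by move=> a b c; apply: functional_extensionality_dep => i; exact: addrA. Qed.
Fact familyDC : commutative (fun a b : family => (fun i => a i + b i) : family).
Proof. by move=> a b; apply: functional_extensionality_dep => i; exact: addrC. Qed.
Fact family0D :
  left_id ((fun i => 0) : family) (fun a b : family => (fun i => a i + b i) : family).
Proof. by move=> a; apply: functional_extensionality_dep => i; exact: add0r. Qed.
Fact familyND : left_inverse ((fun i => 0) : family)
  (fun a : family => (fun i => - a i) : family)
  (fun a b : family => (fun i => a i + b i) : family).
Proof. by move=> a; apply: functional_extensionality_dep => i; exact: addNr. Qed.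

HB.instance Definition _ :=
  GRing.isZmodule.Build family familyDA familyDC family0D familyND.

(** Closure under subtraction needs directedness, and membership of the zero
    family needs an index; both are arguments so that the closure properties can
    be registered as a canonical instance. *)
Definition eventually_zero of directed I & I : {pred family} :=
  fun a => `[< exists i, forall j, (i <= j)%O -> a j = 0 >].

Context (dirI : directed I) (i0 : I).

Fact eventually_zero_zmod_closed : zmod_closed (eventually_zero dirI i0).
Proof.
split=> [|a b]; first by apply/asboolP; exists i0.
move=> /asboolP[i a0] /asboolP[j b0]; apply/asboolP.
have [k [ik jk]] := dirI i j; exists k => l kl.
by change (a l - b l = 0); rewrite a0 ?b0 ?subrr // (le_trans _ kl).
Qed.

HB.instance Definition _ :=
  GRing.isZmodClosed.Build family (eventually_zero dirI i0)
    eventually_zero_zmod_closed.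

Definition germs := {ideal_quot (eventually_zero dirI i0)}.

HB.instance Definition _ := GRing.Zmodule.on germs.
HB.instance Definition _ := EqQuotient.on germs.

Definition germ (a : family) : germs := (\pi_germs a)%qT.

Fact germ_is_zmod_morphism : zmod_morphism germ.
Proof. by move=> a b; rewrite /germ raddfB. Qed.

HB.instance Definition _ :=
  GRing.isZmodMorphism.Build family germs germ germ_is_zmod_morphism.

Lemma eq_germ (a b : family) :
  germ a = germ b <-> exists i, forall j, (i <= j)%O -> a j = b j.
Proof.
have -> : (germ a = germ b) <-> (a - b \in eventually_zero dirI i0).
  by rewrite Quotient.idealrBE; split=> [e|/eqP]; first exact/eqP.
split=> [/asboolP|] [i ab].
  by exists i => j /ab /eqP; rewrite subr_eq0 => /eqP.
apply/asboolP; exists i => j ij.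
by change (a j - b j = 0); rewrite ab // subrr.
Qed.

End EventuallyZero.

Section Tails.
Context {d : Order.disp_t} {I : porderType d} (S : dsystem I).
Hypothesis dirS : is_direct_system S.

(** Below [i], and at indices incomparable with [i], the value is arbitrary as
    far as germs are concerned; [0] makes [tail] additive. *)
Definition tail i (a : S i) : family S := fun j =>
  if pselect (i <= j)%O is left ij then dtrans S ij a else 0.

Lemma tailE i j (ij : (i <= j)%O) (a : S i) : tail a j = dtrans S ij a.
Proof.
rewrite /tail; case: pselect => [ij'|] //.
by rewrite (bool_irrelevance ij' ij).
Qed.

Lemma tail_out i j (a : S i) : ~~ (i <= j)%O -> tail a j = 0.
Proof. by rewrite /tail; case: pselect => // ij /negP[]. Qed.

Fact tail_is_zmod_morphism i : zmod_morphism (@tail i).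
Proof.
move=> a b; apply: functional_extensionality_dep => j.
change (tail (a - b) j = tail a j - tail b j).
have [ij|ij] := boolP (i <= j)%O; last by rewrite !tail_out // subrr.
by rewrite !tailE raddfB.
Qed.

HB.instance Definition _ i :=
  GRing.isZmodMorphism.Build (S i) (family S) (@tail i) (@tail_is_zmod_morphism i).

(** The germs of tails form a cocone, because the tails of [a] and of its image
    at [j] agree from [j] on. It factors through the limit, so the germ of the
    tail of [a] is zero, and directedness provides an index that is both above
    [i] and late enough for the tail to vanish. *)
Lemma direct_limit_eq0 (dirI : directed I) (L : zmodType)
    (iota : forall i, {additive S i -> L}) i (a : S i) :
  is_direct_limit iota -> iota i a = 0 ->
  exists j (ij : (i <= j)%O), dtrans S ij a = 0.
Proof.
move=> [_ univ] a0.
pose t j : {additive S j -> germs S dirI i} := @germ _ _ S dirI i \o @tail j.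
have tS : is_cocone t.
  move=> j k jk b; apply/eq_germ; exists k => l kl.
  change (tail (dtrans S jk b) l = tail b l).
  by rewrite (tailE kl) (tailE (le_trans jk kl)) (dirS.2 _ _ _ _ _ (le_trans jk kl)).
have [u ut _] := univ _ t tS.
have /eq_germ[j aj0] : germ dirI i (tail a) = germ dirI i 0.
  by rewrite raddf0; apply: (etrans (esym (ut i a))); rewrite a0 raddf0.
have [k [ik jk]] := dirI i j; exists k, ik.
by rewrite -tailE; exact: aj0.
Qed.

End Tails.

(** An element of a limit comes from a single index, and if its image in the
    next limit is zero, this is already visible at a later index, where the
    exactness of the system applies. *)
Lemma directed_limits_preserve_exactness {d : Order.disp_t} {I : porderType d}
    (S : dsystem I) : directed I -> limits_preserve_exactness S.
Proof.
move=> dirI A B C f g dirA dirB dirC fS gS exact_fg _ LA LB LC ia ib ic limA limB limC.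
have ibf : is_cocone (fun i => ib i \o f i : {additive A i -> LB}).
  by move=> i j ij a /=; rewrite fS limB.1.
have icg : is_cocone (fun i => ic i \o g i : {additive B i -> LC}).
  by move=> i j ij a /=; rewrite gS limC.1.
have [lf lfE _] := limA.2 _ _ ibf; have [lg lgE _] := limB.2 _ _ icg.
exists lf, lg; split=> //; split.
- have lf_ker x : lf x = 0 -> x = 0.
    have [-> //|[i [a ->]]] := direct_limit_surj dirI x limA.
    rewrite lfE /= => /(direct_limit_eq0 dirB dirI limB)[j [ij]].
    rewrite -fS -(raddf0 (f j)) => fa0.
    by have [/(_ _ _ fa0) a0 _ _] := exact_fg j; rewrite -(limA.1 _ _ ij) a0 raddf0.
  by move=> x y xy; apply/subr0_eq/lf_ker; rewrite raddfB xy subrr.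
- move=> y; split=> [|[x <-]]; last first.
    have [->|[i [a ->]]] := direct_limit_surj dirI x limA; first by rewrite !raddf0.
    rewrite lfE lgE /=; have [_ /(_ (f i a))[_ gf0] _] := exact_fg i.
    by rewrite gf0 ?raddf0 //; exists a.
  have [->|[i [b ->]]] := direct_limit_surj dirI y limB.
    by exists 0; rewrite raddf0.
  rewrite lgE /= => /(direct_limit_eq0 dirC dirI limC)[j [ij]].
  rewrite -gS => gb0; have [_ /(_ (dtrans B ij b))[/(_ gb0)[a fab] _] _] := exact_fg j.
  by exists (ia j a); rewrite lfE /= fab limB.1.
- move=> z; have [->|[i [c ->]]] := direct_limit_surj dirI z limC.
    by exists 0; rewrite raddf0.
  have [_ _ /(_ c)[b <-]] := exact_fg i.
  by exists (ib i b); rewrite lgE.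
Qed.

(** * Functoriality of homology *)

Section Inclusions.
Context {K : choiceType} (mu : K -> int) (n : K -> K -> int).
Local Open Scope fset_scope.

Lemma inclusion_at (D E : {fset K}) k (c : chains mu D k)
    (p : degree_part mu D k) (q : degree_part mu E k) :
  val p = val q -> inclusion E c q = c p.
Proof.
move=> pq; rewrite ffunE (big_pred1 p) // => p'.
by rewrite /= -pq.
Qed.

Lemma inclusion_out (D E : {fset K}) k (c : chains mu D k)
    (q : degree_part mu E k) :
  val q \notin D -> inclusion E c q = 0.
Proof.
move=> qD; rewrite ffunE big1 // => p /eqP pq.
by case/negP: qD; rewrite -pq; have := valP p; rewrite inE => /andP[].
Qed.

Lemma inclusion_id (D : {fset K}) k (c : chains mu D k) : inclusion D c = c.
Proof. by apply/ffunP => p; rewrite (inclusion_at c (p := p)). Qed.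

(** Without [D `<=` E] the left hand side would lose the generators in [D] and
    [F] that are missing from [E]. *)
Lemma inclusion_comp (D E F : {fset K}) k (c : chains mu D k) :
  D `<=` E -> inclusion F (inclusion E c) = inclusion F c.
Proof.
move=> DE; apply/ffunP => r.
have [rE|rE] := boolP (val r \in E); last first.
  by rewrite !inclusion_out //; apply: contra rE; exact: (fsubsetP DE).
have rEk : val r \in degree_part mu E k.
  by have := valP r; rewrite !inE rE => /andP[].
rewrite (inclusion_at _ (p := [` rEk])) // [LHS]ffunE [RHS]ffunE.
exact: eq_bigl.
Qed.

Lemma homology_map_id (D : {fset K}) (DD : chain_compatible_pair mu n D D) k
    (a : homology mu n D k) : homology_map DD a = a.
Proof.
rewrite -[in RHS](reprK a) -[a in LHS]reprK; apply: homology_mapE.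
by rewrite inclusion_id.
Qed.

Lemma homology_map_comp (D E F : {fset K})
    (DE : chain_compatible_pair mu n D E) (EF : chain_compatible_pair mu n E F)
    (DF : chain_compatible_pair mu n D F) k (a : homology mu n D k) :
  D `<=` E -> homology_map EF (homology_map DE a) = homology_map DF a.
Proof.
move=> sDE; apply: homology_mapE => /=.
by rewrite inclusion_comp.
Qed.

End Inclusions.

Section HomologySystemsDirect.
Context {K : choiceType} {mu : K -> int} {n : K -> K -> int} {Et : set {fset K}}.
Hypothesis compat : chain_compatible mu n Et.

Lemma homology_system_direct k : is_direct_system (homology_system compat k).
Proof.
split=> [D DD a|D E F DE EF DF a]; first exact: homology_map_id.
exact: homology_map_comp.
Qed.

Lemma total_homology_system_direct :
  is_direct_system (total_homology_system compat).
Proof.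
split=> [D DD a|D E F DE EF DF a]; apply: dsum_eq => k.
  exact: (homology_system_direct k).1.
exact: (homology_system_direct k).2.
Qed.

Lemma concentrated_graded k :
  is_graded_system (homology_system compat k) (concentrated compat k).
Proof.
split; first exact: homology_system_direct.
  move=> D; split=> [l|a|s c us cl sc0 l ls].
  - split=> [|a b [lk|->]]; [by right|by left|].
    by rewrite sub0r => -[lk|->]; [left|right; rewrite oppr0].
  (* All of the group sits in degree k, so one summand suffices. *)
  - exists [:: k], (fun l => if l == k then a else 0); split=> [l|].
      by have [->|] := eqVneq l k; [left|right].
    by rewrite big_seq1 eqxx.
  (* A summand of degree other than k is zero, so the sum is its term at k. *)
  have [lk|lk] := eqVneq l k; last by case: (cl l) lk => [->|//]; rewrite eqxx.
  rewrite -[RHS]sc0 (bigD1_seq l) //= big1 ?addr0 // => j jl.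
  by case: (cl j) => // jk; rewrite jk lk eqxx in jl.
by move=> D E DE l a [->|->]; [left|right; rewrite raddf0].
Qed.

End HomologySystemsDirect.

(** * Gradings *)

Section DirectSumGrading.
Context {F : int -> zmodType}.

Fact dsum_part_finite k (a : dsum F) :
  finite_set [set i | (if i == k then a i else 0) != 0].
Proof.
apply: (sub_finite_set _ (finite_set1 k)) => i /=.
by case: (eqVneq i k); rewrite ?eqxx.
Qed.

(** The homogeneous part of degree [k], cut out of [a] itself: inserting an
    element of [F k] into the direct sum would require a cast from [F k] to
    [F i] when [i] equals [k]. *)
Definition dsum_part k (a : dsum F) : dsum F := DSum (dsum_part_finite k a).

Definition dsum_at i (a : dsum F) : F i := a i.

Fact dsum_at_is_zmod_morphism i : zmod_morphism (dsum_at i).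
Proof. by []. Qed.

HB.instance Definition _ i :=
  GRing.isZmodMorphism.Build (dsum F) (F i) (dsum_at i) (dsum_at_is_zmod_morphism i).

Lemma dsum_sumE (J : Type) (s : seq J) (c : J -> dsum F) i :
  (\sum_(j <- s) c j : dsum F) i = \sum_(j <- s) c j i.
Proof. exact: (raddf_sum (dsum_at i)). Qed.

Lemma dsum_grading : is_grading (@dsum_degree int F).
Proof.
split=> [k|a|s c us ck sc0 k ks].
- split=> [l //|a b ak bk l lk].
  by change (a l - b l = 0); rewrite ak // bk // subrr.
- have [s sE] : exists s : seq int, [set i | a i != 0] = [set` s].
    exact/finite_seqP/dsum_finite.
  exists (undup s), (dsum_part ^~ a); split=> [k l /= /negPf-> //|].
  apply: dsum_eq => i; rewrite dsum_sumE /=.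
  have [is_|is_] := boolP (i \in undup s).
    rewrite (bigD1_seq i) ?undup_uniq //= eqxx big1 ?addr0 // => j.
    by rewrite eq_sym => /negPf->.
  rewrite big_seq big1 => [|j js]; last first.
    by have [ij|//] := eqVneq i j; rewrite ij js in is_.
  apply/eqP; apply: contraNT is_ => ai0; rewrite mem_undup.
  by have : [set` s] i by rewrite -sE.
apply: dsum_eq => l; have [->|lk] := eqVneq l k; last exact: ck.
have := dsum_sumE s c k; rewrite sc0 (bigD1_seq k) //= big1 ?addr0 // => j jk.
by apply: ck; rewrite eq_sym.
Qed.

End DirectSumGrading.

(** * Limit homology *)

Section LimitHomology.
Context {K : choiceType} {mu : K -> int} {n : K -> K -> int} {Et : set {fset K}}.
Hypothesis compat : chain_compatible mu n Et.

Lemma total_degree_graded :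
  is_graded_system (total_homology_system compat) (total_degree compat).
Proof.
split; first exact: total_homology_system_direct.
  by move=> D; exact: dsum_grading.
by move=> D E DE k a ak l lk /=; rewrite ak // raddf0.
Qed.

Lemma limit_homology_is_well_defined : limit_homology_well_defined compat.
Proof.
split.
  exists (fun k => colimit (homology_system compat k)).
  exists (fun k D => @colimit_in _ _ (homology_system compat k) D).
  by move=> k; exact: colimit_is_direct_limit.
move=> L L' iota iota' lim lim'.
pose iso k := direct_limit_iso (lim k) (lim' k).
pose theta k := sval (cid (iso k)).
pose theta' k := sval (cid (svalP (cid (iso k)))).
have thetaP k := svalP (cid (svalP (cid (iso k)))).
have thetaK k : cancel (theta k) (theta' k) by case: (thetaP k).
have theta'K k : cancel (theta' k) (theta k) by case: (thetaP k).
exists theta; split=> [k||k|].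
- by case: (thetaP k).
- by move=> k; case: (thetaP k).
- by exists (theta' k).
exists (dsum_map theta') => a; apply: dsum_eq => k /=; [exact: thetaK|exact: theta'K].
Qed.

End LimitHomology.

Theorem theorem1p4 (R : realType) (T : tangle R)
    (surface_T : plane_or_closed_surface T)
    (symplectic_T :
       symplectomorphism (tangle_form T) (tangle_map T) (tangle_map_inv T))
    (hyperbolic_T : hyperbolic_fixed_point T)
    (param_s : parametrizes (stable_curve T) (Ws T))
    (param_u : parametrizes (unstable_curve T) (Wu T))
    (transverse_T : transverse T)
    (strong_T : strongly_intersecting T)
    (orient_T : W_orientation_preserving T)
    (Et : set {fset contractible_point T})
    (complete_Et : forall E, Et E ->
       boundary_complete (homoclinic_degree T) (digon_sign T) E)
    (compat : chain_compatible (homoclinic_degree T) (digon_sign T) Et) :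
  [/\ forall k : int, is_graded_system (homology_system compat k)
        (concentrated compat k),
      is_graded_system (total_homology_system compat) (total_degree compat),
      forall k : int, is_direct_system (homology_system compat k) /\
                      has_direct_limit (homology_system compat k) &
      is_direct_system (total_homology_system compat) /\
      has_direct_limit (total_homology_system compat)] /\
  (directed (fset_family Et) ->
   [/\ forall k : int, limits_preserve_exactness (homology_system compat k),
       limits_preserve_exactness (total_homology_system compat) &
       limit_homology_well_defined compat]).

Proof.
have limits (S : dsystem (fset_family Et)) : has_direct_limit S.
  by do 2!eexists; exact: colimit_is_direct_limit.
split=> [|dirEt]; split=> *.
- exact: concentrated_graded.
- exact: total_degree_graded.
- by split=> //; exact: homology_system_direct.
- by split=> //; exact: total_homology_system_direct.
- exact: directed_limits_preserve_exactness.
- exact: directed_limits_preserve_exactness.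
- exact: limit_homology_is_well_defined.
Qed.
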